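(* Let $m \geq 3$, let $n = 2^m - 1$, and let $D$ be any coset of any linear perfect independent dominating set of the hypercube $Q_n$. Then $Q_n - D$ is edge-bipancyclic.
   Context: The hypercube $Q_n$ has vertex set $V(Q_n) = \mathbb{F}_2^n$, two vertices being adjacent iff they differ in exactly one coordinate; $V(Q_n)$ is regarded as a vector space over $\mathbb{F}_2$. For $S \subseteq V(Q_n)$, $Q_n - S$ is the subgraph induced on $V(Q_n)\setminus S$. A perfect independent dominating set (PID set, or perfect code) of a graph is an independent set $D$ of vertices such that every vertex not in $D$ is adjacent to exactly one vertex of $D$. It is linear if it is a linear subspace of $\mathbb{F}_2^n$; a coset of a linear set $D_0$ is a set $D_0 + x$ with $x \in \mathbb{F}_2^n$ (so $D_0$ itself is a coset). A graph $G$ is edge-bipancyclic if for every edge $e$ of $G$ and every even integer $l$ with $4 \leq l \leq |V(G)|$, there is a cycle of length $l$ in $G$ containing $e$. *)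

(* Defs.v *)
From mathcomp Require Import all_boot all_order all_algebra.
Set Implicit Arguments.
Unset Strict Implicit.
Unset Printing Implicit Defensive.
Import GRing.Theory.

Record sgraph := SGraph {
  vertex :> finType;
  adj : rel vertex;
  adj_sym : symmetric adj;
  adj_irrefl : irreflexive adj
}.

Section Induced.
Variables (G : sgraph) (A : {set G}).

Definition induced_vertex : finType := {x : G | x \in A}.

Definition induced_adj : rel induced_vertex :=
  fun x y => adj (val x) (val y).

Lemma induced_adj_sym : symmetric induced_adj.
Proof. by move=> x y; apply: adj_sym. Qed.

Lemma induced_adj_irrefl : irreflexive induced_adj.
Proof. by move=> x; apply: adj_irrefl. Qed.

Definition induced : sgraph := SGraph induced_adj_sym induced_adj_irrefl.

End Induced.

Definition delete_vertices (G : sgraph) (S : {set G}) : sgraph :=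
  induced (~: S).

Definition pid_set (G : sgraph) (D : {set G}) : Prop :=
  (forall x y : G, x \in D -> y \in D -> ~~ adj x y) /\
  (forall v : G, v \notin D -> #|[set d in D | adj v d]| = 1).

(* Cycles are vertex sequences without repetition; the bound on the size
   excludes the closed walks x, y, x, which also satisfy ucycle. *)
Definition is_cycle (G : sgraph) (c : seq G) : Prop :=
  2 < size c /\ ucycle (@adj G) c.

Definition cycle_contains_edge (G : sgraph) (c : seq G) (x y : G) : Prop :=
  (x \in c /\ next c x = y) \/ (y \in c /\ next c y = x).

Definition edge_bipancyclic (G : sgraph) : Prop :=
  forall x y : G, adj x y ->
  forall l : nat, ~~ odd l -> 4 <= l <= #|G| ->
  exists c : seq G,
    [/\ is_cycle c, size c = l & cycle_contains_edge c x y].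

Section Hypercube.
Variable n : nat.

Definition hypercube_adj : rel 'rV['F_2]_n :=
  fun u v => #|[set i | u ord0 i != v ord0 i]| == 1.

Lemma hypercube_adj_sym : symmetric hypercube_adj.
Proof.
move=> u v; rewrite /hypercube_adj; congr (_ == _).
by apply: eq_card => i; rewrite !inE eq_sym.
Qed.

Lemma hypercube_adj_irrefl : irreflexive hypercube_adj.
Proof.
move=> u; rewrite /hypercube_adj (_ : [set _ | _] = set0) ?cards0 //.
by apply/setP=> i; rewrite !inE eqxx.
Qed.

Definition hypercube : sgraph := SGraph hypercube_adj_sym hypercube_adj_irrefl.

Definition linear_set (D : {set 'rV['F_2]_n}) : Prop :=
  exists U : {vspace 'rV['F_2]_n}, D = [set x in U].

Definition coset_of_set (D0 D : {set 'rV['F_2]_n}) : Prop :=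
  exists x : 'rV['F_2]_n, D = [set (d + x)%R | d in D0].

End Hypercube.

(* Main.v *)
(* Let U be the linear code.  For a subspace M containing U, the flips e_i lying
   in M span a subcube through each x in M, and the claim is that for every edge
   {x, x + e_i} outside U, this subcube minus U has a path from x to x + e_i with
   l vertices, for every even l >= 2 up to its order; M = F_2^n is the theorem.
   If M = U + <e_i, x>, the subcube minus U is a 6-cycle, and the claim holds only
   for l = 2 and l = 6, which is enough.  Otherwise choose M' of codimension 1 in M, with
   U, e_i, x in M'.  The directions of M outside M' cut the subcube into slices:
   a slice through y in M' is a punctured cube of the same kind, Hamiltonian by
   induction on dim M, while a slice through y not in M' is a full cube, in which
   all even lengths are available.  Order the slices along a Hamiltonian path from
   x to some x + e_k: it starts in a punctured slice and ends in a full one.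
   Replacing an edge of a Hamiltonian path of a slice by a detour through the rest
   of the chain reaches all even lengths; lengths below that of a punctured slice
   are reached by a detour of the initial edge into the full slice following it. *)
Require Import Defs.
From mathcomp Require Import all_boot all_order all_algebra.
From mathcomp Require Import zify.
Set Implicit Arguments.
Unset Strict Implicit.
Unset Printing Implicit Defensive.
Import GRing.Theory.

(** * Paths with prescribed ends, and detours through a disjoint set *)

Section PathGluing.
Variables (T : finType) (e : rel T).
Implicit Types (A B : {set T}) (u v w z : T) (s t : seq T).

(** The defaults of [head] and [last] are crossed, so the empty list qualifies only when [u = v]. *)
Definition path_in A u v s :=
  [/\ sorted e s, uniq s, {subset s <= A}, head v s = u & last u s = v].

(** Lengths count vertices. As [#|A|] is even, the case [l = #|A|] yields a Hamiltonian path of a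
    nonempty [A]. *)
Definition bipanconnected A u v :=
  ~~ odd #|A| /\
  forall l, ~~ odd l -> 2 <= l <= #|A| ->
  exists2 s, path_in A u v s & size s = l.

Lemma path_in_sub A B u v s :
  A \subset B -> path_in A u v s -> path_in B u v s.
Proof. by move=> /subsetP sAB [? ? sA ? ?]; split=> // x /sA/sAB. Qed.

Lemma path_in_edge A u v :
  u != v -> e u v -> u \in A -> v \in A -> path_in A u v [:: u; v].
Proof.
move=> uv euv uA vA; split=> //=; rewrite ?andbT ?inE //.
by move=> x; rewrite !inE => /pred2P[]->.
Qed.

Lemma path_in_insert A B u v w w' z z' s1 s2 t :
    path_in A u v (s1 ++ z :: z' :: s2) -> path_in B w w' t -> 0 < size t ->
    [disjoint A & B] -> e z w -> e w' z' ->
  path_in (A :|: B) u v (s1 ++ z :: t ++ z' :: s2).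
Proof.
case=> so un sA hd la [sot unt tB]; case: t sot unt tB => // a t sot unt tB /=.
move=> <- {w} lat _ dAB ezw ewz.
have nB x : x \in s1 ++ z :: z' :: s2 -> x \notin B.
  by move/sA => xA; rewrite (disjointFr dAB).
split.
- move: so; rewrite !sorted_cat_cons /= => /and3P[-> _ ps2].
  by rewrite ezw cat_path (sot : path e a t) /= lat ewz.
- have: uniq ((a :: t) ++ (s1 ++ z :: z' :: s2)).
    rewrite cat_uniq unt un andbT; apply/hasPn => x /nB; apply: contra.
    exact: tB.
  by rewrite -(cat_rcons z s1) uniq_catCA cat_rcons.
- move=> x; rewrite inE !(mem_cat, in_cons) => H.
  have: (x \in s1 ++ z :: z' :: s2) || (x \in a :: t).
    by rewrite !(mem_cat, in_cons); case/or4P: H => [->|->|->|/orP[->|/orP[->|->]]];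
       rewrite ?orbT.
  by case/orP => [/sA ->|/tB ->]; rewrite ?orbT.
- by case: s1 hd {so un sA la nB}.
- by move: la; rewrite !last_cat /= last_cat.
Qed.

(** For [l > #|A|], the edge from [z] to [z'] of the Hamiltonian path of [A] is replaced by a detour
    through [l - #|A|] vertices of [B], an even number that is at least 2. *)
Lemma bipanconnected_glue A B u v w w' z z' s1 s2 :
    path_in A u v (s1 ++ z :: z' :: s2) ->
    size (s1 ++ z :: z' :: s2) = #|A| -> ~~ odd #|A| ->
    (forall l, ~~ odd l -> 2 <= l <= #|A| ->
       exists2 s, path_in (A :|: B) u v s & size s = l) ->
    [disjoint A & B] -> e z w -> e w' z' -> bipanconnected B w w' ->
  bipanconnected (A :|: B) u v.
Proof.
move=> ps szs oA short dAB ezw ewz [oB hB].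
have cAB : #|A :|: B| = #|A| + #|B|.
  by rewrite cardsU (disjoint_setI0 dAB) cards0 subn0.
split; first by rewrite cAB oddD (negbTE oA) (negbTE oB).
move=> l ol; rewrite cAB => /andP[l2 lAB].
have [lA|lA] := leqP l #|A|; first by apply: short; rewrite ?l2.
have [] := hB (l - #|A|); [by lia | by lia |] => t pt szt.
exists (s1 ++ z :: t ++ z' :: s2).
  by apply: path_in_insert ps pt _ _ _ _ => //; lia.
by move: szs; rewrite !size_cat /= !size_cat /=; lia.
Qed.

End PathGluing.

(** * Paths in subcubes *)

Section Cube.
Variable n : nat.
Local Notation V := ('rV['F_2]_n).
Local Notation e_ i := (delta_mx 0%R i : V).
Local Notation qadj := (@hypercube_adj n).
Implicit Types (x y u v : V) (J : {set 'I_n}) (i j k : 'I_n).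
Local Open Scope ring_scope.

Lemma F2_neq (a b : 'F_2) : a != b -> a = b + 1.
Proof.
by case: a => [[|[|?]] ?]; case: b => [[|[|?]] ?] //= _; apply/val_inj.
Qed.

Lemma addF2 (a : 'F_2) : a + a = 0.
Proof. by case: a => [[|[|?]] ?] //=; apply/val_inj. Qed.

Lemma addvv x : x + x = 0.
Proof. by apply/rowP=> i; rewrite !mxE addF2. Qed.

Lemma addvvK x : cancel (+%R^~ x) (+%R^~ x).
Proof. by move=> y /=; rewrite -addrA addvv addr0. Qed.

Lemma unitE i j : e_ i 0 j = (j == i)%:R.
Proof. by rewrite mxE eqxx. Qed.

Lemma unit_inj : injective (fun i => e_ i).
Proof.
move=> i j /rowP/(_ i) /eqP; rewrite !unitE eqxx.
by case: (i =P j) => // _; rewrite oner_eq0.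
Qed.

Lemma addv_unit_neq u i : u != u + e_ i.
Proof.
apply/eqP => /rowP/(_ i); rewrite mxE unitE eqxx => /eqP.
by rewrite addrC eq_sym -subr_eq0 addrK oner_eq0.
Qed.

Lemma qadjP u v : reflect (exists i, v = u + e_ i) (qadj u v).
Proof.
apply: (iffP cards1P) => [[i /setP H]|[i ->]]; exists i.
  apply/rowP=> j; rewrite mxE unitE; move: (H j); rewrite !inE.
  case: eqP => [->|/eqP ne]; case: eqP => //= _ _; first by rewrite addr0.
  by apply: F2_neq; rewrite eq_sym.
apply/setP => j; rewrite !inE mxE unitE.
have [_|_] := eqVneq j i; last by rewrite addr0 eqxx.
by rewrite addrC eq_sym -subr_eq0 addrK oner_eq0.
Qed.

Lemma qadj_unit u i : qadj u (u + e_ i).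
Proof. by apply/qadjP; exists i. Qed.

Definition parity u : 'F_2 := \sum_i u 0 i.

Lemma parity_unit u i : parity (u + e_ i) = parity u + 1.
Proof.
rewrite /parity (bigD1 i) //= (bigD1 i (F := fun j => u 0 j)) //=.
rewrite mxE unitE eqxx -!addrA; congr (_ + _); rewrite addrC; congr (_ + _).
by apply: eq_bigr => j /negbTE ji; rewrite mxE unitE ji addr0.
Qed.

Lemma parity_path u p : path qadj u p -> parity (last u p) = parity u + (size p)%:R.
Proof.
elim: p u => [|v p IH] u /=; first by rewrite addr0.
by case/andP => /qadjP[i ->] /IH ->; rewrite parity_unit mulrS addrA.
Qed.

(** Every step changes the parity and the two ends have opposite parities, so the number of edges is
    odd. *)
Lemma path_in_even (A : {set V}) u i s :
  path_in qadj A u (u + e_ i) s -> ~~ odd (size s).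
Proof.
case=> so _ _; case: s so => // a p /= so <- /(congr1 parity).
rewrite (parity_path so) parity_unit => /addrI /(congr1 val) /=.
by rewrite val_Fp_nat // modn2 negbK; case: (odd _).
Qed.

(** The coset of [x] modulo the span of the [e_ i] with [i] in [J], described by coordinates. *)
Definition cube x J : {set V} :=
  [set y : V | [forall i, (i \notin J) ==> (y 0 i == x 0 i)]].

Lemma cubeP x J y : reflect (forall i, i \notin J -> y 0 i = x 0 i) (y \in cube x J).
Proof.
rewrite inE; apply: (iffP forallP) => H i.
  by move=> iJ; apply/eqP; move: (H i); rewrite iJ.
by apply/implyP => /H ->.
Qed.

Lemma mem_cube x J : x \in cube x J.
Proof. exact/cubeP. Qed.

Lemma cube_unit x J u i :
  u \in cube x J -> (u + e_ i \in cube x J) = (i \in J).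
Proof.
move=> /cubeP uc; apply/cubeP/idP => [H|iJ j jJ].
  apply/negPn/negP => iJ; move: (H i iJ); rewrite mxE unitE eqxx -(uc i iJ).
  by move/eqP; rewrite -subr_eq0 addrAC subrr add0r oner_eq0.
rewrite mxE unitE uc //; case: eqP => [ji|]; last by rewrite addr0.
by move: jJ; rewrite ji iJ.
Qed.

Lemma cube_eq x J u : u \in cube x J -> cube u J = cube x J.
Proof.
move=> /cubeP uc; apply/setP=> y; apply/cubeP/cubeP => H i iJ;
  by rewrite H // uc.
Qed.

Lemma cube_shift x J y v : (y + v \in cube (x + v) J) = (y \in cube x J).
Proof.
apply/cubeP/cubeP => H i iJ; last by rewrite !mxE H.
by move: (H i iJ); rewrite !mxE => /addIr.
Qed.

Lemma cube_split x J k : k \in J ->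
  cube x J = cube x (J :\ k) :|: cube (x + e_ k) (J :\ k).
Proof.
move=> kJ; apply/setP => y; rewrite in_setU; apply/cubeP/orP => [H|].
  have [yk|/F2_neq yk] := eqVneq (y 0 k) (x 0 k); [left|right];
    apply/cubeP=> i; rewrite !inE negb_and negbK.
    by case/orP => [/eqP->|/H].
  rewrite mxE unitE; have [->//|ik] := eqVneq i k.
  by move/H->; rewrite addr0.
by case=> /cubeP H i iJ; rewrite H ?inE ?negb_and ?iJ ?orbT // mxE unitE;
  case: eqP => [ik|]; rewrite ?addr0 //; move: iJ; rewrite ik kJ.
Qed.

Lemma cube_disjoint x y J : y \notin cube x J -> [disjoint cube x J & cube y J].
Proof.
move=> xy; apply/pred0P => z /=; apply/negP => /andP[/cube_eq zx /cube_eq zy].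
by rewrite -zx zy mem_cube in xy.
Qed.

Lemma card_cube x J : #|cube x J| = (2 ^ #|J|)%N.
Proof.
move eqm: #|J| => m; elim: m x J eqm => [|m IH] x J eqm.
  move/eqP: eqm; rewrite cards_eq0 => /eqP->; apply/eqP/cards1P; exists x.
  apply/setP=> y; rewrite in_set1; apply/cubeP/eqP => [H|-> //].
  by apply/rowP => i; rewrite H ?inE.
have /set0Pn[k kJ] : J != set0 by rewrite -card_gt0 eqm.
have cJ : #|J :\ k| = m by move: eqm; rewrite (cardsD1 k) kJ => -[].
rewrite (cube_split x kJ) cardsU disjoint_setI0; last first.
  by apply: cube_disjoint; rewrite cube_unit ?mem_cube // !inE eqxx.
by rewrite cards0 subn0 !IH // expnS mul2n addnn.
Qed.

(** Induction on [#|J|]. The cube splits along some [k != i]: the half through [u] supplies the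
    short lengths, and the first edge of a Hamiltonian path of that half is detoured through the
    opposite half. *)
Lemma cube_bipanconnected u J i :
  i \in J -> bipanconnected qadj (cube u J) u (u + e_ i).
Proof.
move eqm: #|J| => m; elim: m u J i eqm => [|m IH] u J i eqm iJ.
  by move/eqP: eqm; rewrite cards_eq0 => /eqP J0; rewrite J0 inE in iJ.
have [J1|/set0Pn[k]] := eqVneq (J :\ i) set0.
  have cJ : #|cube u J| = 2%N by rewrite card_cube (cardsD1 i) iJ J1 cards0.
  rewrite /bipanconnected cJ; split=> // l _ l2.
  have ->: l = 2%N by lia.
  exists [:: u; u + e_ i] => //.
  by apply: path_in_edge; rewrite ?addv_unit_neq ?qadj_unit ?cube_unit ?mem_cube.
rewrite !inE => /andP[ki kJ]; rewrite (cube_split u kJ).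
have cJ : #|J :\ k| = m by move: eqm; rewrite (cardsD1 k) kJ => -[].
have iJ' : i \in J :\ k by rewrite !inE eq_sym ki.
have cA : (2 <= #|cube u (J :\ k)|)%N.
  by rewrite card_cube (cardsD1 i) iJ' expnS leq_pmulr ?expn_gt0.
have [oA hA] := IH u _ i cJ iJ'.
have [s ps szs] := hA _ oA ltac:(by rewrite cA leqnn).
case: s ps szs => [|z [|z' s]] ps szs; [by rewrite -szs in cA|by rewrite -szs in cA|].
have := ps; case=> /= /andP[/qadjP[a z'E] _] _ sA zu _.
have uA := mem_cube u (J :\ k).
have aJ : a \in J :\ k.
  by have := sA z'; rewrite in_cons mem_head orbT z'E zu cube_unit //; apply.
rewrite z'E zu in ps szs.
apply: (bipanconnected_glue (s1 := [::]) ps szs oA _ _ (qadj_unit u k) _ (IH (u + e_ k) _ a cJ aJ)).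
- move=> l ol /(hA _ ol)[t pt <-]; exists t => //.
  by apply: path_in_sub pt; apply: subsetUl.
- by apply: cube_disjoint; rewrite cube_unit // !inE eqxx.
- by apply/qadjP; exists k; rewrite addrAC addvvK.
Qed.


Lemma even_sub2 (l b : nat) : ~~ odd l -> (2 <= l)%N -> l != 2%N -> (l <= b)%N ->
  [/\ ~~ odd (l - 2), (2 <= l - 2 <= b)%N, (0 < l - 2)%N & (l - 2).+2 = l].
Proof. by move=> *; split; lia. Qed.

(** * Linear perfect codes *)

Variable U : {vspace V}.
(** The first two hypotheses say that the code has minimum distance at least 3, the third that its
    covering radius is at most 1. *)
Hypothesis unit_notin : forall i, e_ i \notin U.
Hypothesis unit2_in : forall i j, e_ i + e_ j \in U -> i = j.
Hypothesis dominating : forall v, v \notin U -> exists i, v + e_ i \in U.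
Implicit Type M : {vspace V}.

Definition dirs M : {set 'I_n} := [set i | e_ i \in M].

Lemma mem_dirs M i : (i \in dirs M) = (e_ i \in M).
Proof. exact: in_set. Qed.

Definition punctured x M : {set V} := cube x (dirs M) :\: [set y in U].

(** Only the greatest length is carried through the induction: in a 6-cycle, two adjacent vertices
    are not joined by a path with four vertices. *)
Definition hamiltonian_slices M :=
  forall u i, u \in M -> e_ i \in M -> u \notin U -> u + e_ i \notin U ->
  exists2 s, path_in qadj (punctured u M) u (u + e_ i) s
    & size s = #|punctured u M|.

(** The difference [y - x] is a combination of unit vectors lying in [M]. *)
Lemma mem_cube_dirs x y M : y \in cube x (dirs M) -> (y \in M) = (x \in M).
Proof.
move=> /cubeP yc; have d : y - x \in M.
  rewrite [y - x]row_sum_delta; apply: memv_suml => i _.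
  have [iM|iM] := boolP (i \in dirs M); first by rewrite memvZ // -mem_dirs.
  by rewrite !mxE yc // subrr scale0r mem0v.
apply/idP/idP => [yM|xM]; last by rewrite -[y](subrK x) memvD.
by rewrite -[x](subKr y) memvB.
Qed.

Lemma mem_punctured x M y :
  (y \in punctured x M) = (y \notin U) && (y \in cube x (dirs M)).
Proof. by rewrite in_setD in_set. Qed.

Lemma punctured_eq x u M :
  u \in cube x (dirs M) -> punctured u M = punctured x M.
Proof. by move/cube_eq; rewrite /punctured => ->. Qed.

Lemma punctured_full x M :
  (U <= M)%VS -> x \notin M -> punctured x M = cube x (dirs M).
Proof.
move=> /subvP UM xM; apply/setP=> y; rewrite mem_punctured andb_idl // => yc.
by apply: contra xM => /UM; rewrite (mem_cube_dirs yc).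
Qed.

(** Both [y] and [y'] agree with [x] on [J] and with [z] off [J]. Hence slices through distinct
    vertices of a transversal cube are disjoint. *)
Lemma cube_transverse x y y' z J :
  y \in cube x (~: J) -> y' \in cube x (~: J) ->
  z \in cube y J -> z \in cube y' J -> y = y'.
Proof.
move=> /cubeP yx /cubeP y'x /cubeP zy /cubeP zy'; apply/rowP => i.
have [iJ|iJ] := boolP (i \in J); first by rewrite yx ?y'x // in_setC iJ.
by rewrite -zy // zy'.
Qed.

(* Points of the code at distance at most 2 coincide, so of three consecutive
   vertices of the shifted path at most one lies in the code. *)
Lemma exists_good_edge s j :
    sorted qadj s -> uniq s -> (4 <= size s)%N ->
  exists s1 z z' s2, [/\ s = s1 ++ z :: z' :: s2,
    z + e_ j \notin U & z' + e_ j \notin U].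
Proof.
have no1 v a : v + e_ j \in U -> v + e_ a + e_ j \notin U.
  move=> vU; rewrite addrAC; apply: contra (unit_notin a) => H.
  by rewrite -(addKr (v + e_ j) (e_ a)) addrC memvB.
have no2 v a b : v != v + e_ a + e_ b -> v + e_ j \in U ->
    v + e_ a + e_ b + e_ j \notin U.
  move=> vn vU; apply: contra vn => H.
  suff /unit2_in-> : e_ a + e_ b \in U by rewrite addvvK.
  by rewrite -(addKr (v + e_ j) (e_ a + e_ b)) addrC memvB // addrAC addrA.
case: s => [|x0 [|x1 [|x2 [|x3 s]]]] //= /and4P[/qadjP[a E1] /qadjP[b E2]].
move=> /qadjP[c E3] _; rewrite !inE !negb_or => /andP[/and3P[_ n02 _] /andP[/and3P[_ n13 _] _]] _.
have [x1U|x1U] := boolP (x1 + e_ j \in U).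
  exists [:: x0; x1], x2, x3, s; split=> //; first by rewrite E2 no1.
  by rewrite E3 E2 no2 // -E2 -E3.
have [x2U|x2U] := boolP (x2 + e_ j \in U); last by exists [:: x0], x1, x2, (x3 :: s).
exists [::], x0, x1, [:: x2, x3 & s]; split=> //.
by apply: contraL x2U => x0U; rewrite E2 E1 no2 // -E1 -E2.
Qed.

(** * Chains of slices *)

Definition chain M (ys : seq V) : {set V} :=
  [set z | (z \notin U) && has (fun y => z \in cube y (dirs M)) ys].

Lemma mem_chain M ys z :
  (z \in chain M ys) = (z \notin U) && has (fun y => z \in cube y (dirs M)) ys.
Proof. by rewrite in_set. Qed.

Lemma chain_cons M y ys : chain M (y :: ys) = punctured y M :|: chain M ys.
Proof.
by apply/setP=> z; rewrite in_setU mem_punctured !mem_chain /= andb_orr.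
Qed.

(** Induction on [ys], gluing the slice through [y] to the rest of the chain. The end outside [M]
    makes the base case a full cube; two directions in [M] give a full slice the four vertices that
    [exists_good_edge] requires. *)
Lemma chain_bipanconnected M x y ys u i :
    (U <= M)%VS -> hamiltonian_slices M -> (2 <= #|dirs M|)%N ->
    path qadj y ys -> uniq (y :: ys) ->
    {subset y :: ys <= cube x (~: dirs M)} -> last y ys \notin M ->
    i \in dirs M -> u \in cube y (dirs M) -> u \notin U -> u + e_ i \notin U ->
  bipanconnected qadj (chain M (y :: ys)) u (u + e_ i).
Proof.
move=> UM hamM dM; elim: ys y u i => [|y' ys IH] y u i.
  move=> _ _ _ /= yM iM uy uU uiU.
  have -> : chain M [:: y] = cube u (dirs M).
    rewrite chain_cons punctured_full // (cube_eq uy).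
    apply/setP => z; rewrite in_setU mem_chain /= andbF orbF //.
  exact: cube_bipanconnected.
move=> /= /andP[/qadjP[j y'E] pys] /andP[yys uys] sub lastM iM uy uU uiU.
have yx : y \in cube x (~: dirs M) by apply: sub; rewrite mem_head.
have y'x : y' \in cube x (~: dirs M) by apply: sub; rewrite in_cons mem_head orbT.
have jM : j \notin dirs M by rewrite -in_setC -(cube_unit _ yx) -y'E.
have dis : [disjoint punctured y M & chain M (y' :: ys)].
  apply/pred0P => z /=; rewrite mem_punctured mem_chain.
  apply/negP => /andP[/andP[_ zy] /andP[_ /hasP[y2 y2s zy2]]].
  case/negP: yys; rewrite (cube_transverse yx _ zy zy2) //.
  by apply: sub; rewrite in_cons y2s orbT.
have shiftE z : (z + e_ j \in cube y' (dirs M)) = (z \in cube y (dirs M)).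
  by rewrite y'E cube_shift.
(* The induction hypothesis applies to the translate by [e_ j] of an edge of the slice, once both
   translated ends avoid [U]. *)
have {IH}bip v a : v \in cube y (dirs M) -> v + e_ a \in cube y (dirs M) ->
    v + e_ j \notin U -> v + e_ a + e_ j \notin U ->
    bipanconnected qadj (chain M (y' :: ys)) (v + e_ j) (v + e_ a + e_ j).
  move=> vy vay vU vaU; rewrite addrAC; apply: IH => //.
  - by move=> y2 y2s; apply: sub; rewrite in_cons y2s orbT.
  - by rewrite -(cube_unit _ vy).
  - by rewrite shiftE.
  - by rewrite addrAC.
have uiy : u + e_ i \in cube y (dirs M) by rewrite (cube_unit _ uy).
rewrite chain_cons; have [yM|yM] := boolP (y \in M); last first.
  (* Full slice: the next one may be punctured, so the edge to be detoured has to be chosen with a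
     translate avoiding [U]. *)
  rewrite punctured_full // in dis *; rewrite -(cube_eq uy) in dis *.
  have [oA hA] := cube_bipanconnected u iM.
  have cA : (4 <= #|cube u (dirs M)|)%N.
    by rewrite card_cube (leq_pexp2l (isT : 0 < 2)%N dM).
  have [s ps szs] := hA _ oA ltac:(by rewrite leqnn (leq_trans _ cA)).
  have [so us sA _ _] := ps.
  have [|s1 [z [z' [s2 [sE zU z'U]]]]] := exists_good_edge j so us; first by rewrite szs.
  rewrite sE in ps szs so sA.
  have zA : z \in cube y (dirs M).
    by rewrite -(cube_eq uy) sA // mem_cat mem_head orbT.
  have z'A : z' \in cube y (dirs M).
    by rewrite -(cube_eq uy) sA // mem_cat !in_cons eqxx !orbT.
  move: so; rewrite sorted_cat_cons /= => /and3P[_ /qadjP[a z'E] _].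
  rewrite z'E in ps szs z'A z'U.
  apply: (bipanconnected_glue ps szs oA _ dis (qadj_unit _ _) _ (bip _ _ zA z'A zU z'U)).
  - move=> l ol /(hA _ ol)[t pt <-]; exists t => //.
    by apply: path_in_sub pt; apply: subsetUl.
  - by rewrite hypercube_adj_sym qadj_unit.
have inM v : v \in cube y (dirs M) -> v \in M by move/mem_cube_dirs->.
(* Punctured slice: translation by [e_ j] leaves [M], hence avoids [U], and any edge may be
   detoured. *)
have shiftU v : v \in cube y (dirs M) -> v + e_ j \notin U.
  move=> /inM vM; apply: contra jM => /(subvP UM) H.
  by rewrite mem_dirs -(addKr v (e_ j)) addrC memvB.
have eiM : e_ i \in M by rewrite -mem_dirs.
have [s] := hamM u i (inM _ uy) eiM uU uiU.
rewrite (punctured_eq uy) => ps szs.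
have oA : ~~ odd #|punctured y M| by rewrite -szs; apply: path_in_even ps.
have uA : u \in punctured y M by rewrite mem_punctured uU.
have uiA : u + e_ i \in punctured y M by rewrite mem_punctured uiU.
(* Translation by [e_ j] embeds this slice into the rest of the chain, which therefore offers every
   even length up to the order of the slice. *)
have leAB : (#|punctured y M| <= #|chain M (y' :: ys)|)%N.
  rewrite -(card_imset _ (can_inj (addvvK (e_ j)))); apply: subset_leq_card.
  apply/subsetP=> _ /imsetP[z zA ->]; rewrite mem_chain.
  by move: zA; rewrite mem_punctured => /andP[_ zy]; rewrite shiftU //= shiftE zy.
have short l : ~~ odd l -> (2 <= l <= #|punctured y M|)%N ->
    exists2 s0, path_in qadj (punctured y M :|: chain M (y' :: ys)) u (u + e_ i) s0
      & size s0 = l.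
  move=> ol /andP[l2 lA]; have edge : path_in qadj (punctured y M) u (u + e_ i) [:: u; u + e_ i].
    by apply: path_in_edge => //; [apply: addv_unit_neq | apply: qadj_unit].
  have [->|lne] := eqVneq l 2%N.
    by exists [:: u; u + e_ i] => //; apply: path_in_sub edge; apply: subsetUl.
  have [_ hB] := bip u i uy uiy (shiftU _ uy) (shiftU _ uiy).
  (* The ends [u] and [u + e_ i] account for two vertices, the detour for the other [l - 2]. *)
  have [ol2 l2B l2_gt0 l2E] := even_sub2 ol l2 lne (leq_trans lA leAB).
  have [t pt szt] := hB _ ol2 l2B.
  exists (u :: t ++ [:: u + e_ i]); last by rewrite /= size_cat /= szt addn1.
  apply: (path_in_insert (s1 := [::]) edge pt _ dis (qadj_unit _ _)); first by rewrite szt.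
  by rewrite hypercube_adj_sym qadj_unit.
case: s ps szs => [|z [|z' s]] ps szs.
- by case: ps => _ _ _ /= /esym/eqP; rewrite (negbTE (addv_unit_neq u i)).
- by case: ps => _ _ _ /= -> /eqP; rewrite (negbTE (addv_unit_neq u i)).
have := ps; case=> /= /andP[/qadjP[a z'E] _] _ sA zu _.
have z'A : u + e_ a \in cube y (dirs M).
  by have := sA z'; rewrite in_cons mem_head orbT mem_punctured z'E zu => /(_ isT)/andP[].
rewrite z'E zu in ps szs.
apply: (bipanconnected_glue (s1 := [::]) ps szs oA short dis (qadj_unit u j) _
  (bip u a uy z'A (shiftU _ uy) (shiftU _ z'A))).
by rewrite hypercube_adj_sym qadj_unit.
Qed.

(** * Induction on the dimension of the subspace *)

Lemma cube_subset x J J' : J \subset J' -> cube x J \subset cube x J'.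
Proof.
move=> /subsetP JJ; apply/subsetP => y /cubeP yc; apply/cubeP => l lJ.
by apply: yc; apply: contra lJ => /JJ.
Qed.

(** Vectors of [M] are adjoined to [P] one at a time, until one more fills [M]. *)
Lemma hyperplane_between (P M : {vspace V}) :
    (P <= M)%VS -> ~~ (M <= P)%VS ->
  exists M' v, [/\ (P <= M')%VS, v \notin M' & M = (M' + <[v]>)%VS].
Proof.
have [d] := ubnP (\dim M - \dim P); elim: d P => // d IH P led PM MP.
have [v vM vP] := subvPn MP.
have PvM : (P + <[v]> <= M)%VS by rewrite subv_add PM -memvE.
have [MPv|MPv] := boolP (M <= P + <[v]>)%VS.
  by exists P, v; split; rewrite ?subvv //; apply/eqP; rewrite eqEsubv MPv.
have [|M' [w [PM' wM' ME]]] := IH _ _ PvM MPv; last first.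
  by exists M', w; split=> //; apply: subv_trans PM'; apply: addvSl.
have : (\dim P < \dim (P + <[v]>))%N.
  rewrite (ltn_leqif (dimv_leqif_sup (addvSl P <[v]>))) subv_add subvv.
  by rewrite -memvE.
by have := dimvS PM; have := dimvS PvM; clear -led; lia.
Qed.

Lemma spanning_subset x K s :
  uniq s -> {subset s <= cube x K} -> size s = #|cube x K| -> s =i cube x K.
Proof.
move=> us sub szs z; rewrite -(mem_enum (cube x K)).
apply: (uniq_min_size us _ _).2 => [y|]; first by rewrite mem_enum => /sub.
by rewrite -cardE szs.
Qed.

Lemma punctured_bipanconnected M x i :
    (U <= M)%VS ->
    (forall M', (U <= M')%VS -> (\dim M' < \dim M)%N -> hamiltonian_slices M') ->
    x \in M -> e_ i \in M -> x \notin U -> x + e_ i \notin U ->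
    ~~ (M <= U + (<[e_ i]> + <[x]>))%VS ->
  bipanconnected qadj (punctured x M) x (x + e_ i).
Proof.
move=> UM ham xM iM xU xiU MP.
have PM : (U + (<[e_ i]> + <[x]>) <= M)%VS by rewrite !subv_add UM -!memvE iM.
have [M' [v [PM' vM' ME]]] := hyperplane_between PM MP.
move: PM'; rewrite !subv_add -!memvE => /and3P[UM' iM' xM'].
have M'M : (M' <= M)%VS by rewrite ME addvSl.
have vM : v \in M by rewrite memvE ME addvSr.
have dimM' : (\dim M' < \dim M)%N.
  rewrite (ltn_leqif (dimv_leqif_sup M'M)); apply/negP => /subvP/(_ _ vM).
  by apply/negP.
set K := dirs M :\: dirs M'.
(* The vector [v] lies outside [U], so some [v + e_ k] is in the code. As [v] is in [M] but not in
   [M'], so is [e_ k]: a transversal direction exists. *)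
have [k kU] := dominating (contra (subvP UM' v) vM').
have kM : e_ k \in M by rewrite -(addKr v (e_ k)) addrC memvB // (subvP UM).
have kM' : e_ k \notin M'.
  by apply: contra vM' => kM'; rewrite -(addvvK (e_ k) v) memvD // (subvP UM').
have kK : k \in K by rewrite in_setD !mem_dirs kM' kM.
have [oK hK] := cube_bipanconnected x kK.
have cK : (2 <= #|cube x K|)%N.
  by rewrite card_cube (cardsD1 k) kK expnS leq_pmulr ?expn_gt0.
have [ys pys szys] := hK _ oK ltac:(by rewrite cK leqnn).
have [sys uys sub hd la] := pys.
have ysE := spanning_subset uys sub szys.
case: ys {pys szys} sys uys sub hd la ysE => [|y ys] //= pys uys sub yx la ysE.
  by move/eqP: yx; rewrite eq_sym (negbTE (addv_unit_neq _ _)).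
rewrite {y}yx in pys uys sub la ysE.
have chainE : chain M' (x :: ys) = punctured x M.
  apply/setP=> z; rewrite mem_chain mem_punctured; congr (_ && _).
  apply/hasP/idP => [[y]|zx].
    rewrite ysE => /cubeP yx /cubeP zy; apply/cubeP => l lM.
    rewrite zy ?yx // ?in_setD ?(negbTE lM) ?andbF //.
    by apply: contra lM; rewrite !mem_dirs => /(subvP M'M).
  (* The slice containing [z] is found by projecting [z] to the transversal cube. *)
  exists (\row_l if l \in K then z 0 l else x 0 l).
    by rewrite ysE; apply/cubeP => l lK; rewrite mxE (negbTE lK).
  apply/cubeP => l lM'; rewrite mxE in_setD lM' /=; case: ifPn => // lM.
  by move/cubeP: zx => ->.
(* The direction from [x] to the code is a second direction of [M']; it differs from [i] because
   [x + e_ i] is not in the code. *)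
have [j jU] := dominating xU.
have jM' : e_ j \in M' by rewrite -(addKr x (e_ j)) addrC memvB // (subvP UM').
rewrite -chainE; apply: (chain_bipanconnected (x := x) UM' (ham _ UM' dimM')) => //.
- have <- : #|[set i; j]| = 2%N.
    by rewrite cards2; case: eqP => // ij; rewrite ij jU in xiU.
  by apply: subset_leq_card; rewrite subUset !sub1set !mem_dirs iM' jM'.
- move=> y /sub; apply/subsetP/cube_subset; apply/subsetP => l.
  by rewrite in_setD in_setC => /andP[].
- by rewrite la; apply: contra kM' => H; rewrite -(addKr x (e_ k)) addrC memvB.
- by rewrite mem_dirs.
- exact: mem_cube.
Qed.

(** A unit vector of [M] is congruent modulo [U] to 0, [x], [e_ i] or [x + e_ i]. The minimum
    distance rules out the first case and forces the index [j], [i] or [k] in the others. *)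
Lemma dirs_plane M x i j k :
    (M <= U + (<[e_ i]> + <[x]>))%VS -> x + e_ j \in U -> x + e_ i + e_ k \in U ->
  dirs M \subset [set i; j; k].
Proof.
move=> MP jU kU; apply/subsetP => l; rewrite mem_dirs => /(subvP MP).
case/memv_addP => w wU [_ /memv_addP[_ /vlineP[a ->] [_ /vlineP[b ->] ->]] lE].
rewrite !inE.
have scaleE (c : 'F_2) (y : V) : c *: y = 0 \/ c *: y = y.
  have [->|/F2_neq ->] := eqVneq c 0; [left|right]; by rewrite ?scale0r ?add0r ?scale1r.
have same m y : e_ l = w + y -> y + e_ m \in U -> l = m.
  move=> yE yU; apply: unit2_in; rewrite -[e_ l](addvvK y) -addrA memvD //.
  by rewrite yE addvvK.
case: (scaleE a (e_ i)) lE => ->; case: (scaleE b x) => ->; rewrite ?add0r ?addr0 => lE.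
- by case/negP: (unit_notin l); rewrite lE.
- by rewrite (same _ _ lE jU) eqxx orbT.
- by rewrite (same i _ lE) ?eqxx // addvv mem0v.
- by rewrite (same k _ lE) ?eqxx ?orbT // [_ + x]addrC.
Qed.

Lemma card_set3_le (T : finType) (a b c : T) : (#|[set a; b; c]| <= 3)%N.
Proof. by rewrite setUC cardsU1 cards2; case: (c \notin _); case: (a != b). Qed.

(** The subcube is a 3-cube with directions [i], [j], [k], in which [x + e_ j] and [x + e_ i + e_ k]
    are antipodal code points. Removing them leaves a 6-cycle, which [s] traverses. *)
Lemma punctured_plane_hamiltonian M x i :
    (U <= M)%VS -> (M <= U + (<[e_ i]> + <[x]>))%VS ->
    x \in M -> e_ i \in M -> x \notin U -> x + e_ i \notin U ->
  exists2 s, path_in qadj (punctured x M) x (x + e_ i) s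
    & size s = #|punctured x M|.
Proof.
move=> UM MP xM iM xU xiU.
have [j jU] := dominating xU; have [k kU] := dominating xiU.
have nU y a : y \in U -> y + e_ a \notin U.
  move=> yU; apply: contra (unit_notin a) => H.
  by rewrite -(addKr y (e_ a)) addrC memvB.
have ij : i != j by apply: contraNneq xiU => ->.
have ik : i != k by apply: contraNneq xU => ik; rewrite -ik addvvK in kU.
have jk : j != k by apply: contraTneq kU => <-; rewrite addrAC nU.
have jM : e_ j \in M by rewrite -(addKr x (e_ j)) addrC memvB // (subvP UM).
have kM : e_ k \in M.
  by rewrite -(addKr (x + e_ i) (e_ k)) addrC memvB ?(subvP UM _ kU) ?memvD.
have xk : x + e_ k \notin U.
  by apply: contraL kU => H; rewrite addrAC nU.
pose s := [:: x; x + e_ k; x + e_ k + e_ j; x + e_ k + e_ j + e_ i;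
              x + e_ j + e_ i; x + e_ i].
have us : uniq s.
  (* The offsets from [x] in the coordinates [i], [j], [k] already separate the six vertices. *)
  apply: (@map_uniq _ _ (fun y => (y 0 i - x 0 i, y 0 j - x 0 j, y 0 k - x 0 k))).
  have shift1 (a : 'F_2) : a + 1 - a = 1 by rewrite addrAC subrr add0r.
  rewrite /= !mxE !eqxx (negbTE ij) (negbTE ik) (negbTE jk) ![_ == i]eq_sym.
  rewrite [k == j]eq_sym (negbTE ij) (negbTE ik) (negbTE jk) /= !addr0.
  by rewrite !subrr !shift1.
have sub : {subset s <= punctured x M}.
  have cM y a : y \in cube x (dirs M) -> e_ a \in M -> y + e_ a \in cube x (dirs M).
    by move=> yx aM; rewrite (cube_unit _ yx) mem_dirs.
  have xx := mem_cube x (dirs M).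
  move=> y; rewrite mem_punctured !in_cons in_nil orbF.
  case/or4P => [/eqP->|/eqP->|/eqP->|/or3P[]/eqP->]; apply/andP; split; rewrite ?cM //.
  - by rewrite addrAC nU.
  - by rewrite addrAC [x + _ + _]addrAC nU.
  - by rewrite nU.
exists s.
  split=> //=; rewrite !qadj_unit /= andbT; apply/andP; split; apply/qadjP.
    by exists k; rewrite [x + e_ k + e_ j]addrAC [x + e_ j + e_ k + e_ i]addrAC addvvK.
  by exists j; rewrite [x + e_ j + e_ i]addrAC addvvK.
apply/eqP; rewrite eqn_leq; apply/andP; split.
  by rewrite cardE; apply: uniq_leq_size => // y /sub; rewrite mem_enum.
(* For the other inequality, the cube has at most 8 vertices and at least two of them are in the
   code. *)
have dM : (#|dirs M| <= 3)%N.
  by apply: leq_trans (subset_leq_card (dirs_plane MP jU kU)) _; apply: card_set3_le.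
have cub : (#|cube x (dirs M)| <= 8)%N.
  by rewrite card_cube (leq_pexp2l (isT : 0 < 2)%N dM).
rewrite /punctured cardsD; change (size s) with 6%N.
suff : (2 <= #|cube x (dirs M) :&: [set y in U]|)%N by clear -cub; lia.
have ne : x + e_ j != x + e_ i + e_ k.
  apply/eqP => /rowP/(_ j); rewrite !mxE !eqxx [j == i]eq_sym (negbTE ij) (negbTE jk).
  by rewrite /= !addr0 => /eqP; rewrite addrC -subr_eq0 addrK oner_eq0.
apply: (@leq_trans #|[set x + e_ j; x + e_ i + e_ k]|); first by rewrite cards2 ne.
apply: subset_leq_card; rewrite subUset !sub1set !in_setI ![_ \in [set y in U]]in_set.
have xi : x + e_ i \in cube x (dirs M) by rewrite cube_unit ?mem_cube ?mem_dirs.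
by rewrite jU kU (cube_unit _ (mem_cube _ _)) (cube_unit _ xi) !mem_dirs jM kM.
Qed.

(** Strong induction on [\dim M]; outside the plane case, the Hamiltonian path is the one of
    greatest even length. *)
Lemma hamiltonian_slices_all M : (U <= M)%VS -> hamiltonian_slices M.
Proof.
have [d] := ubnP (\dim M); elim: d M => // d IH M led UM u i uM iM uU uiU.
have [MP|MP] := boolP (M <= U + (<[e_ i]> + <[u]>))%VS.
  exact: punctured_plane_hamiltonian.
have [|oM hM] := punctured_bipanconnected UM _ uM iM uU uiU MP.
  by move=> M' UM' dM'; apply: IH => //; exact: leq_trans dM' led.
apply: hM => //; rewrite leqnn andbT.
(* The two ends show that the order of the slice is at least 2, hence an admissible length. *)
have : [set u; u + e_ i] \subset punctured u M.
  by rewrite subUset !sub1set !mem_punctured uU uiU mem_cube cube_unit ?mem_cube // mem_dirs.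
by move/subset_leq_card; rewrite cards2 addv_unit_neq.
Qed.

(** This is the case [M = fullv]. The exceptional plane cannot occur, since it has at most three
    directions whereas all [n > 3] directions are present. *)
Lemma setC_code_bipanconnected x i :
    (3 < n)%N -> x \notin U -> x + e_ i \notin U ->
  bipanconnected qadj [set y | y \notin U] x (x + e_ i).
Proof.
move=> n3 xU xiU.
have -> : [set y | y \notin U] = punctured x fullv.
  apply/setP=> y; rewrite in_set mem_punctured; case: (y \in U) => //=.
  by apply/esym/cubeP => j; rewrite mem_dirs memvf.
apply: punctured_bipanconnected; rewrite ?subvf ?memvf //.
  by move=> M' UM' _; apply: hamiltonian_slices_all.
apply/negP => MP.
have [j jU] := dominating xU; have [k kU] := dominating xiU.
have := subset_leq_card (dirs_plane MP jU kU).
have -> : dirs fullv = setT by apply/setP=> l; rewrite mem_dirs memvf in_setT.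
rewrite cardsT card_ord => /leq_trans/(_ (card_set3_le i j k)).
by rewrite leqNgt n3.
Qed.

End Cube.

(** * From paths to cycles of the induced subgraph *)

Lemma induced_cycle (G : sgraph) (A : {set G}) (x y : induced A) s :
    adj x y -> path_in (@adj G) A (val x) (val y) s -> 2 < size s ->
  exists c : seq (induced A),
    [/\ is_cycle c, size c = size s & cycle_contains_edge c x y].
Proof.
move=> xy [so us sA hd la] sz.
have [c cE] : exists c : seq (induced A), s = map val c.
  (* All vertices of [s] lie in [A], so [insub] discards none of them. *)
  exists (pmap insub s); rewrite (pmap_filter (insubK _)).
  by apply/esym/all_filterP/allP => z /sA zA; rewrite insubT.
exists c; rewrite cE size_map in sz hd la so us *.
rewrite (map_inj_uniq val_inj) in us; rewrite sorted_map in so.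
case: c sz hd la so us {cE} => // a p sz /= /val_inj ax; rewrite {a}ax in sz *.
rewrite last_map => /val_inj yE pp up; split=> //.
  split=> //; apply/andP; split; last exact: up.
  rewrite /= rcons_path (pp : path _ x p) yE /=.
  by rewrite induced_adj_sym.
(* The prescribed edge is the closing one, from the last vertex [y] to [x]: the index of [y] in the
   cycle is [size p], so [nth] on [p] returns its default [x]. *)
right; rewrite -yE mem_last; split=> //.
by rewrite next_nth mem_last index_last // nth_default.
Qed.

Theorem theorem4p9 (m n : nat) (hm : 3 <= m) (hn : n = 2 ^ m - 1)
    (D0 D : {set hypercube n}) (hlin : linear_set D0) (hpid : pid_set D0)
    (hcoset : coset_of_set D0 D) :
  edge_bipancyclic (delete_vertices D).
Proof.
have n3 : 3 < n by rewrite hn; have := leq_pexp2l (isT : 0 < 2) hm; lia.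
case: hlin hpid hcoset => U -> {D0} [indep dom] [t DE].
(* The code contains 0, and independence excludes the neighbours of 0. *)
have unit_notin i : (delta_mx 0 i : 'rV['F_2]_n)%R \notin U.
  apply/negP => iU; have := indep 0%R (delta_mx 0 i)%R.
  rewrite !in_set mem0v iU => /(_ isT isT)/negP; apply.
  by rewrite -[X in adj _ X]add0r; apply: qadj_unit.
have dominating v : v \notin U -> exists i, (v + delta_mx 0 i)%R \in U.
  move=> vU; have := dom v; rewrite in_set => /(_ vU)/eqP/cards1P[d /setP/(_ d)].
  by rewrite in_set1 eqxx !in_set => /andP[dU /qadjP[i dE]]; exists i; rewrite -dE.
have unit2_in i j : (delta_mx 0 i + delta_mx 0 j : 'rV['F_2]_n)%R \in U -> i = j.
  (* The vertex [delta_mx 0 i] is outside the code and adjacent to the code points 0 and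
     [delta_mx 0 i + delta_mx 0 j], which coincide by uniqueness. *)
  move=> ijU; have := dom (delta_mx 0 i)%R; rewrite in_set => /(_ (unit_notin i)).
  move=> /eqP/cards1P[d /setP dE].
  have a0 : @adj (hypercube n) (delta_mx 0 i)%R 0%R.
    by apply/qadjP; exists i; rewrite addvv.
  have aij : @adj (hypercube n) (delta_mx 0 i)%R (delta_mx 0 i + delta_mx 0 j)%R.
    exact: qadj_unit.
  have := dE 0%R; have := dE (delta_mx 0 i + delta_mx 0 j)%R.
  rewrite !in_set1 !in_set ijU mem0v a0 aij /=.
  move=> /esym/eqP <- /esym/eqP/esym ij0; apply: (@unit_inj n).
  by rewrite -[LHS](addvvK (delta_mx 0 j)%R) ij0 add0r.
(* Over ['F_2], translation by [t] is an involution, exchanging [D] and [U]. *)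
have memD y : (y \in D) = ((y + t)%R \in U).
  rewrite DE; apply/imsetP/idP => [[d]|yU].
    by rewrite in_set => dU ->; rewrite addvvK.
  by exists (y + t)%R; rewrite ?in_set ?addvvK.
move=> x y xy l ol /andP[l4 lG].
have [i yE] := qadjP _ _ xy.
have xU : (val x + t)%R \notin U by rewrite -memD -in_setC (valP x).
have yU : (val x + t + delta_mx 0 i)%R \notin U.
  by rewrite addrAC -yE -memD -in_setC (valP y).
have [_ /(_ l ol)[]] := setC_code_bipanconnected unit_notin unit2_in dominating n3 xU yU.
  rewrite (leq_trans _ l4) //=; apply: leq_trans lG _; rewrite card_sig.
  rewrite -(card_imset _ (can_inj (addvvK t))); apply: subset_leq_card.
  by apply/subsetP => _ /imsetP[z zD ->]; rewrite in_set -memD -in_setC.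
move=> s [so us sU hd la] sz.
have s0 : 0 < size s by rewrite sz (leq_trans _ l4).
(* The path found in the complement of [U] is translated back to the complement of [D]. *)
pose f (z : 'rV['F_2]_n) := (z + t)%R.
have pf : path_in (@adj (hypercube n)) (~: D) (val x) (val y) (map f s).
  split.
  - rewrite sorted_map; apply: sub_sorted so => u v /qadjP[j ->].
    by apply/qadjP; exists j; rewrite /f addrAC.
  - by rewrite map_inj_uniq //; apply: can_inj (addvvK t).
  - move=> _ /mapP[z zs ->]; rewrite in_setC memD addvvK.
    by have := sU z zs; rewrite in_set.
  - by case: s s0 hd {sz so us sU la} => // a s _ /= ->; rewrite /f addvvK.
  - case: s s0 la {sz so us sU hd} => // a s _ /= E.
    by rewrite last_map E /f addrAC addvvK -yE.
have [|c [cc szc ce]] := induced_cycle xy pf; first by rewrite size_map sz (leq_trans _ l4).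
by exists c; split=> //; rewrite szc size_map.
Qed.
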